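(* For every arbitrarily small constant $\varepsilon>0$, the pure liquid price of stability of the VCG auction, over games in which all (budget-constrained) players have additive valuation functions, is at least $2-\varepsilon$.
   Context: Setting: $m$ items are allocated to $n$ players. Player $i$ has a valuation function $v_i:2^{[m]}\to\mathbb{R}_{\ge 0}$ and a private budget $c_i\in\mathbb{R}_{\ge 0}$. A valuation is additive if $v_i(S\cup T)=v_i(S)+v_i(T)$ for disjoint $S,T\subseteq[m]$, i.e. $v_i(S)=\sum_{j\in S}v_i(\{j\})$. VCG auction: each player $i$ submits a bid $b_i(S)\ge 0$ for every bundle $S\subseteq[m]$; $\mathbf{b}=(b_i(S))_{i\in[n],S\subseteq[m]}$. For an allocation $\mathbf{Y}=(Y_1,\dots,Y_n)$ (a partition of $[m]$ among the players) write $b_i(\mathbf{Y})=b_i(Y_i)$. VCG outputs an allocation $\mathbf{X}=\mathbf{X}(\mathbf{b})\in\arg\max_{\mathbf{Y}}\sum_{i\in[n]}b_i(\mathbf{Y})$ and charges player $i$ the payment $p_i(\mathbf{b})=\max_{\mathbf{Y}}\sum_{\ell\ne i}b_\ell(\mathbf{Y})-\sum_{\ell\ne i}b_\ell(\mathbf{X})$. Utility: $u_i(\mathbf{b})=v_i(X_i)-p_i(\mathbf{b})$ if $p_i(\mathbf{b})\le c_i$, and $-\infty$ otherwise. $\mathbf{b}$ is a pure Nash equilibrium if no player can strictly increase her utility by unilaterally changing her bids. $\mathrm{EQ}(\mathcal{G})$ is the set of equilibria of the game $\mathcal{G}$. Conservative behavior (standing assumption): players' bids satisfy $b_i(S)\le\min\{v_i(S),c_i\}$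 for every bundle $S$. Liquid welfare: $\mathrm{LW}(\mathbf{X})=\sum_{i\in[n]}\min\{v_i(X_i),c_i\}$. The pure liquid price of stability is $\mathrm{LPoS}=\sup_{\mathcal{G}}\frac{\max_{\mathbf{Y}}\mathrm{LW}(\mathbf{Y})}{\max_{\mathbf{b}\in\mathrm{EQ}(\mathcal{G})}\mathrm{LW}(\mathbf{X}(\mathbf{b}))}$, the supremum being over all games induced by the auction. *)

(* Defs.v *)
From HB Require Import structures.
From mathcomp Require Import all_boot all_order all_algebra.
From mathcomp Require Import boolp classical_sets reals ereal.

Set Implicit Arguments.
Unset Strict Implicit.
Unset Printing Implicit Defensive.

Local Open Scope ring_scope.

(* An ordered partition (Y_1, ..., Y_n) of the m items is encoded by the map
   sending each item to the player who receives it. *)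
Definition allocation (n m : nat) := {ffun 'I_m -> 'I_n}.

Definition bundle (n m : nat) (Y : allocation n m) (i : 'I_n) : {set 'I_m} :=
  [set j | Y j == i]%SET.

Definition profile (R : realType) (n m : nat) := 'I_n -> {set 'I_m} -> R.

Definition nonneg_profile (R : realType) (n m : nat) (b : profile R n m) :=
  forall i S, 0 <= b i S.

Definition bid_welfare (R : realType) (n m : nat) (b : profile R n m)
  (Y : allocation n m) : R := \sum_(i < n) b i (bundle Y i).

Definition bid_welfare_others (R : realType) (n m : nat) (b : profile R n m)
  (i : 'I_n) (Y : allocation n m) : R :=
  \sum_(l < n | l != i) b l (bundle Y l).

(* The allocation depends on the bids only, and ties are broken by X.  The
   number of players is n.+1 since m > 0 items cannot be allocated to nobody. *)
Definition allocation_rule (R : realType) :=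
  forall n m : nat, profile R n.+1 m -> allocation n.+1 m.

Definition VCG_rule (R : realType) (X : allocation_rule R) :=
  forall (n m : nat) (b : profile R n.+1 m), nonneg_profile b ->
  forall Y : allocation n.+1 m, bid_welfare b Y <= bid_welfare b (X n m b).

(* The default value 0 of the maximum is harmless: bids are nonnegative and
   there is at least one allocation. *)
Definition payment (R : realType) (X : allocation_rule R) (n m : nat)
  (b : profile R n.+1 m) (i : 'I_n.+1) : R :=
  \big[Num.max/0]_(Y : allocation n.+1 m) bid_welfare_others b i Y
  - bid_welfare_others b i (X n m b).

Record game (R : realType) (n m : nat) := Game {
  valuation : 'I_n -> {set 'I_m} -> R;
  budget : 'I_n -> R;
  valuation_ge0 : forall i S, 0 <= valuation i S;
  budget_ge0 : forall i, 0 <= budget i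
}.

Definition additive (R : realType) (m : nat) (v : {set 'I_m} -> R) :=
  forall S T : {set 'I_m}, [disjoint S & T] -> v (S :|: T)%SET = v S + v T.

Definition utility (R : realType) (X : allocation_rule R) (n m : nat)
  (G : game R n.+1 m) (b : profile R n.+1 m) (i : 'I_n.+1) : \bar R :=
  if payment X b i <= budget G i
  then (valuation G i (bundle (X n m b) i) - payment X b i)%:E
  else -oo%E.

Definition conservative (R : realType) (n m : nat) (G : game R n m) (i : 'I_n)
  (bi : {set 'I_m} -> R) :=
  forall S, 0 <= bi S <= Num.min (valuation G i S) (budget G i).

Definition deviate (R : realType) (n m : nat) (b : profile R n m) (i : 'I_n)
  (bi : {set 'I_m} -> R) : profile R n m :=
  fun l => if l == i then bi else b l.

Local Open Scope classical_set_scope.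

(* Conservativeness restricts the strategy sets, so it applies to the
   equilibrium bids and to the deviations alike. *)
Definition EQ (R : realType) (X : allocation_rule R) (n m : nat)
  (G : game R n.+1 m) : set (profile R n.+1 m) :=
  [set b | (forall i, conservative G i (b i)) /\
     forall i bi, conservative G i bi ->
       (utility X G (deviate b i bi) i <= utility X G b i)%E].

Definition LW (R : realType) (n m : nat) (G : game R n m)
  (Y : allocation n m) : R :=
  \sum_(i < n) Num.min (valuation G i (bundle Y i)) (budget G i).

Definition opt_LW (R : realType) (n m : nat) (G : game R n m) : R :=
  \big[Num.max/0]_(Y : allocation n m) LW G Y.

(* When [EQ X G] is nonempty this supremum is a maximum, because LW takes
   finitely many values. *)
Definition best_EQ_LW (R : realType) (X : allocation_rule R) (n m : nat)
  (G : game R n.+1 m) : \bar R :=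
  ereal_sup [set (LW G (X n m b))%:E | b in EQ X G].

(* Games without a pure equilibrium are left out, the ratio being undefined for
   them.  In [\bar R], r / 0 = +oo for r > 0, and 0 / 0 = 0. *)
Definition LPoS (R : realType) (X : allocation_rule R)
  (C : forall n m : nat, set (game R n m)) : \bar R :=
  ereal_sup [set r | exists (n m : nat) (G : game R n.+1 m),
    [/\ C n.+1 m G, EQ X G !=set0 & r = ((opt_LW G)%:E / best_EQ_LW X G)%E]].

Definition additive_games (R : realType) (n m : nat) : set (game R n m) :=
  [set G | forall i, additive (valuation G i)].

(* Main.v *)
(* Two items and two players.  Player 0 values each item at 1 and has budget 1;
   player 1 values only the second item, at 1 - delta, and has budget
   1 - delta.  Giving one item to each player yields liquid welfare 2 - delta.
   By bidding 1 on the grand bundle and 0 elsewhere, player 0 wins everything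
   against any conservative bid, at a price of at most 1 - delta, hence gets
   utility at least 1 + delta; one item alone is worth only 1.  So she wins both
   items in every equilibrium, where the liquid welfare is her budget 1.
   Equilibria exist for every tie-breaking rule: player 0 makes that bid and
   player 1 bids 0. *)
Require Import Defs.
From HB Require Import structures.
From mathcomp Require Import all_boot all_order all_algebra.
From mathcomp Require Import boolp classical_sets reals ereal.
From mathcomp Require Import lra.

Set Implicit Arguments.
Unset Strict Implicit.
Unset Printing Implicit Defensive.

Import Order.TTheory GRing.Theory Num.Theory.

Local Open Scope ring_scope.

Lemma payment_ge0 (R : realType) (X : allocation_rule R) n m
  (b : profile R n.+1 m) i : 0 <= payment X b i.
Proof. by rewrite subr_ge0; exact: le_bigmax. Qed.

Lemma additive_set0 (R : realType) m (v : {set 'I_m} -> R) :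
  Defs.additive v -> v finset.set0 = 0.
Proof.
move=> /(_ finset.set0 finset.set0); rewrite finset.disjoints_subset finset.sub0set.
by move=> /(_ isT); rewrite finset.setU0; lra.
Qed.

Definition grand_bid (R : realType) m (S : {set 'I_m}) : R :=
  (S == [set: 'I_m]%SET)%:R.

Definition all_to_first n m : allocation n.+1 m := [ffun=> ord0].

Lemma bundle_all_to_first n m (i : 'I_n.+1) :
  bundle (all_to_first n m) i = if i == ord0 then [set: 'I_m]%SET else finset.set0.
Proof.
apply/setP => j; rewrite inE ffunE eq_sym.
by case: ifP => _; rewrite inE.
Qed.

Lemma bundle_setT_all_to_first n m (Y : allocation n.+1 m) :
  bundle Y ord0 = [set: 'I_m]%SET -> Y = all_to_first n m.
Proof.
move=> /setP YT; apply/ffunP => j; rewrite ffunE.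
by have := YT j; rewrite !inE => /eqP.
Qed.

Lemma bid_welfare2 (R : realType) m (b : profile R 2 m) Y :
  bid_welfare b Y = b ord0 (bundle Y ord0) + b ord_max (bundle Y ord_max).
Proof.
rewrite /bid_welfare big_ord_recl big_ord1.
by rewrite (_ : lift _ _ = ord_max) //; exact: val_inj.
Qed.

Lemma bid_welfare_others0 (R : realType) m (b : profile R 2 m) Y :
  bid_welfare_others b ord0 Y = b ord_max (bundle Y ord_max).
Proof.
rewrite /bid_welfare_others (bigD1 ord_max) //= big1 ?addr0 // => l.
by case: l => -[|[|]] // ? /andP[].
Qed.

Lemma bid_welfare_others1 (R : realType) m (b : profile R 2 m) Y :
  bid_welfare_others b ord_max Y = b ord0 (bundle Y ord0).
Proof.
rewrite /bid_welfare_others (bigD1 ord0) //= big1 ?addr0 // => l.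
by case: l => -[|[|]] // ? /andP[].
Qed.

Section BadGame.
Variables (R : realType) (X : allocation_rule R) (hX : VCG_rule X).
Variable delta : R.
Hypotheses (delta_gt0 : 0 < delta) (delta_le1 : delta <= 1).

Definition bad_valuation (i : 'I_2) (S : {set 'I_2}) : R :=
  if i == ord0 then #|S|%:R else (1 - delta) * (ord_max \in S)%:R.

Definition bad_budget (i : 'I_2) : R := if i == ord0 then 1 else 1 - delta.

Let bad_valuation_ge0 i S : 0 <= bad_valuation i S.
Proof.
rewrite /bad_valuation; case: ifP => _; first exact: ler0n.
by rewrite mulr_ge0 ?ler0n ?subr_ge0.
Qed.

Let bad_budget_ge0 i : 0 <= bad_budget i.
Proof. by rewrite /bad_budget; case: ifP => _ //; rewrite subr_ge0. Qed.

Definition bad_game : game R 2 2 := Game bad_valuation_ge0 bad_budget_ge0.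

Lemma bad_game_additive : additive_games bad_game.
Proof.
move=> i S T dST /=; rewrite /bad_valuation; case: ifP => _.
  by rewrite cardsU disjoint_setI0 // cards0 subn0 natrD.
rewrite -mulrDr -natrD inE; case: (boolP (ord_max \in S)) => [maxS|//].
by rewrite (disjointFr dST maxS).
Qed.

Lemma bad_valuation_set0 i : bad_valuation i finset.set0 = 0.
Proof. exact: (additive_set0 (bad_game_additive i)). Qed.

Lemma grand_bid_conservative : conservative bad_game ord0 (@grand_bid R 2).
Proof.
move=> S; rewrite /grand_bid ler0n /= /bad_valuation /bad_budget /= le_min.
case: eqP => [->|_]; last by rewrite mulr0n ler0n ler01.
by rewrite cardsT card_ord lexx ler1n.
Qed.

Lemma zero_bid_conservative i : conservative bad_game i (fun=> 0).
Proof. by move=> S; rewrite lexx le_min bad_valuation_ge0 bad_budget_ge0. Qed.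

Lemma conservative1_le b S : conservative bad_game ord_max b ->
  b S <= 1 - delta.
Proof. by move=> /(_ S)/andP[_]; rewrite le_min => /andP[]. Qed.

Lemma conservative1_set0 b : conservative bad_game ord_max b ->
  b finset.set0 = 0.
Proof.
move=> /(_ finset.set0)/andP[b0]; rewrite le_min.
rewrite /= bad_valuation_set0 => /andP[b0' _].
by apply/le_anti; rewrite b0 b0'.
Qed.

Section GrandBid.
Variable b : profile R 2 2.
Hypotheses (b0E : b ord0 = @grand_bid R 2)
  (b1_cons : conservative bad_game ord_max (b ord_max)).

(** If player 0 misses an item, her bid contributes 0 and the bid welfare is at most [1 - delta],
    strictly below the 1 obtained by giving her everything. The strict gap makes tie-breaking
    irrelevant. *)
Lemma grand_bid_wins : X b = all_to_first 1 2.
Proof.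
have b_ge0 : nonneg_profile b.
  move=> i S; have [->|i0] := eqVneq i ord0; first by rewrite b0E ler0n.
  have -> : i = ord_max by case: i i0 => -[|[|]] // *; exact: val_inj.
  by have /andP[] := b1_cons S.
have := hX b_ge0 (all_to_first 1 2).
rewrite !bid_welfare2 !bundle_all_to_first /= conservative1_set0 // addr0 b0E.
rewrite {1}/grand_bid eqxx /grand_bid.
case: eqP => [/bundle_setT_all_to_first //|_].
have := conservative1_le (bundle (X b) ord_max) b1_cons.
by rewrite mulr1n mulr0n add0r => le1 /le_trans-/(_ _ le1); rewrite lerBrDr gerDl leNgt delta_gt0.
Qed.

(** Player 0 pays her externality on player 1, who receives nothing and could declare at most her
    budget. *)
Lemma grand_bid_payment0 : payment X b ord0 <= 1 - delta.
Proof.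
rewrite /payment bid_welfare_others0 grand_bid_wins bundle_all_to_first /=.
rewrite conservative1_set0 // subr0; apply: bigmax_le => [|Y _].
  by rewrite subr_ge0.
by rewrite bid_welfare_others0; exact: conservative1_le.
Qed.

(** Player 0 already attains her highest bid, so player 1 displaces nobody. *)
Lemma grand_bid_payment1 : payment X b ord_max = 0.
Proof.
apply/le_anti; rewrite payment_ge0 andbT subr_le0.
rewrite bid_welfare_others1 grand_bid_wins bundle_all_to_first /= b0E.
rewrite /grand_bid eqxx; apply: bigmax_le => // Y _.
by rewrite bid_welfare_others1 b0E lern1 leq_b1.
Qed.

Lemma grand_bid_utility0 :
  utility X bad_game b ord0 = (2 - payment X b ord0)%:E.
Proof.
rewrite /utility /= /bad_budget /= (le_trans grand_bid_payment0); last first.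
  by rewrite gerBl ltW.
by rewrite /bad_valuation /= grand_bid_wins bundle_all_to_first cardsT card_ord.
Qed.

Lemma grand_bid_utility1 : utility X bad_game b ord_max = 0%:E.
Proof.
rewrite /utility grand_bid_payment1 bad_budget_ge0 subr0.
rewrite grand_bid_wins bundle_all_to_first /=.
by rewrite bad_valuation_set0.
Qed.

End GrandBid.

(** This holds for arbitrary bids, since overspending gives [-oo]. It serves twice: to rule out
    profitable deviations of player 0, and to recover from her equilibrium utility how many items
    she wins. *)
Lemma bad_utility0_le b :
  (utility X bad_game b ord0 <= (#|bundle (X b) ord0|%:R)%:E)%E.
Proof.
rewrite /utility; case: ifP => _; last exact: leNye.
by rewrite lee_fin gerBl payment_ge0.
Qed.

Lemma bad_EQ_nonempty : (EQ X bad_game !=set0)%classic.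
Proof.
pose b : profile R 2 2 := fun i => if i == ord0 then @grand_bid R 2 else fun=> 0.
have b_cons i : conservative bad_game i (b i).
  rewrite /b; case: eqP => [->|_]; first exact: grand_bid_conservative.
  exact: zero_bid_conservative.
exists b; split => // i bi bi_cons.
have [i0|i0] := eqVneq i ord0.
  subst i; rewrite (grand_bid_utility0 (b := b)) //.
  (* Against zero bids player 0 gets both items for free, so her utility 2 is the largest
     conceivable. *)
  have -> : payment X b ord0 = 0.
    apply/le_anti; rewrite payment_ge0 andbT subr_le0 bid_welfare_others0 /=.
    by apply: bigmax_le => // Y _; rewrite bid_welfare_others0.
  apply: (le_trans (bad_utility0_le _)); rewrite subr0 lee_fin ler_nat.
  by rewrite (leq_trans (max_card _)) ?card_ord.
have i1 : i = ord_max by case: i {bi_cons} i0 => -[|[|]] // *; exact: val_inj.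
(* Player 0 still makes the grand bid after player 1 deviates, so player 1 has utility 0 both before
   and after. *)
by subst i; rewrite !grand_bid_utility1 // /deviate eqxx.
Qed.

Lemma bad_EQ_allocation b : EQ X bad_game b -> X b = all_to_first 1 2.
Proof.
move=> [b_cons /(_ ord0 _ grand_bid_conservative)].
set b' := deviate _ _ _ => b_eq.
have b'1 : conservative bad_game ord_max (b' ord_max) by exact: b_cons.
have := le_trans b_eq (bad_utility0_le b).
rewrite grand_bid_utility0 // lee_fin => le_card.
(* The deviation [b'] guarantees at least [2 - (1 - delta) = 1 + delta], so the equilibrium must
   give player 0 more than one item. *)
have gt1 : (1 < #|bundle (X b) ord0|)%N.
  rewrite -(ltr_nat R); have := grand_bid_payment0 (erefl : b' ord0 = _) b'1.
  by move: le_card delta_gt0; lra.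
apply: bundle_setT_all_to_first; apply/eqP.
by rewrite finset.eqEcard finset.subsetT cardsT card_ord.
Qed.

Lemma bad_best_EQ_LW : best_EQ_LW X bad_game = 1%:E.
Proof.
have LW1 b : EQ X bad_game b -> LW bad_game (X b) = 1.
  move=> /bad_EQ_allocation ->.
  rewrite /LW big_ord_recl big_ord1 !bundle_all_to_first /=.
  rewrite bad_valuation_set0 /bad_valuation /bad_budget /=.
  by rewrite cardsT card_ord (min_idPr _) ?ler1n // (min_idPl _) ?addr0 // subr_ge0.
have [b0 b0_EQ] := bad_EQ_nonempty.
(* An equilibrium must exist here: the supremum of the empty set would be [-oo]. *)
rewrite /best_EQ_LW (_ : image _ _ = [set 1%:E]%classic) ?ereal_sup1 //.
apply/seteqP; split => [_ [b b_EQ <-]|_ ->] /=; first by rewrite LW1.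
by exists b0 => //; rewrite LW1.
Qed.

Lemma bad_opt_LW : 2 - delta <= opt_LW bad_game.
Proof.
(* The identity map gives item i to player i; both players then reach their budgets exactly. *)
apply: le_trans (le_bigmax _ _ ([ffun j => j] : allocation 2 2)).
have bundleE i : bundle ([ffun j => j] : allocation 2 2) i = [set i]%SET.
  by apply/setP => j; rewrite !inE ffunE.
rewrite /LW big_ord_recl big_ord1 !bundleE /= /bad_valuation /bad_budget /=.
rewrite cards1 minxx (_ : lift _ _ = ord_max); last exact: val_inj.
by rewrite inE eqxx mulr1 minxx; lra.
Qed.

End BadGame.

Theorem theorem7 (R : realType) (X : allocation_rule R) (hX : VCG_rule X)
  (eps : R) (heps : 0 < eps) :
  ((2 - eps)%:E <= LPoS X (@additive_games R))%E.
Proof.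
(* Capping at 1 keeps the budget [1 - delta] nonnegative when [eps] is large. *)
pose delta := Num.min eps 1.
have delta_gt0 : 0 < delta by rewrite lt_min heps ltr01.
have delta_le1 : delta <= 1 by rewrite ge_min lexx orbT.
have delta_le : delta <= eps by rewrite ge_min lexx.
pose G := bad_game delta_le1.
(* The best equilibrium has liquid welfare 1, so the ratio for [G] is its optimum. *)
apply: (@le_trans _ _ (opt_LW G)%:E).
  by rewrite lee_fin; have := bad_opt_LW delta_le1; rewrite -/G; lra.
(* The first witness is 1 because [LPoS] counts players as [n.+1]. *)
apply: ereal_sup_ubound; exists 1%N, 2%N, G; split.
- exact: bad_game_additive.
- exact: bad_EQ_nonempty.
- by rewrite bad_best_EQ_LW // inver oner_eq0 invr1 mule1.
Qed.
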